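(* Let $n\ge 1$ and let $H=\{w_1,\ldots,w_T\}\subset\mathbb{R}^{n+1}$ be a finite set of nonzero, pairwise non-proportional vectors (the normal vectors of a finite central hyperplane arrangement in $\mathbb{R}^{n+1}$) which spans $\mathbb{R}^{n+1}$. Let $K^H$ be the simplicial complex with vertex set $H$ in which a subset $\{w_{j_1},\ldots,w_{j_s}\}\subseteq H$ forms a simplex iff $\operatorname{span}(w_{j_1},\ldots,w_{j_s})\neq\mathbb{R}^{n+1}$, and let $\mathbb{F}$ be an arbitrary field. Let $p=(p_1,\ldots,p_T)$ be any probability distribution on $H$ ($p_j\ge 0$, $\sum_{j=1}^T p_j=1$, $p_j$ being the weight of $w_j$). Then $$\operatorname{rank}\,\tilde H_{n-1}\left(K^H;\mathbb{F}\right)=\sum_{W\in H^{\times n}_{\ne 0}}\frac{1-\sum_{j:\,w_j\in L_n(W)\cap H}p_j}{W[H]},$$ where, for $W=(w_{i_1},\ldots,w_{i_n})$, $L_n(W)=\operatorname{span}(w_{i_1},\ldots,w_{i_n})$ (so the numerator is $1$ minus the total weight of the $q_n^W$ vectors of $H$ lying in $L_n(W)$, which include $w_{i_1},\ldots,w_{i_n}$).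
   Context: $H^{\times n}_{\ne 0}$ denotes the set of ordered $n$-tuples $W=(w_{i_1},\ldots,w_{i_n})$ of distinct vectors of $H$ that are linearly independent, i.e. $\dim\operatorname{span}(w_{i_1},\ldots,w_{i_n})=n$. For such $W$ and $l=1,\ldots,n$, put $L_l(W)=\operatorname{span}(w_{i_{n-l+1}},\ldots,w_{i_n})$ and $q_l^W=|L_l(W)\cap H|$ (the number of vectors of $H$ lying in $L_l(W)$). Then $W[H]:=q_n^W\cdot q_{n-1}^W\cdots q_1^W$. $\tilde H_{n-1}$ denotes reduced simplicial homology, and $\operatorname{rank}$ its dimension as an $\mathbb{F}$-vector space. *)

(* Defs.v *)
From HB Require Import structures.
From mathcomp Require Import all_boot all_order all_algebra.
From mathcomp Require Import reals.

Set Implicit Arguments.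
Unset Strict Implicit.
Unset Printing Implicit Defensive.

Import Order.TTheory GRing.Theory Num.Theory.
Local Open Scope ring_scope.

(* Abstract simplicial complexes with vertices in 'I_T. The empty face is
   always present, so that the chain complex below is the augmented one. *)
Record complex (T : nat) := Complex {
  faces :> {set {set 'I_T}};
  faces0 : set0 \in faces;
  facesS : forall s t : {set 'I_T}, t \subset s -> s \in faces -> t \in faces
}.

Section ReducedHomology.
Variables (F : fieldType) (T : nat).

(* F^o, rather than F, carries the F-module structure needed for scaling. *)
Local Notation C := {ffun {set 'I_T} -> F^o}.

Definition simplex (s : {set 'I_T}) : C := [ffun t => (t == s)%:R].

(* The vertices are ordered by index; deleting the vertex v from s carries
   the sign (-1)^i, where i is the number of vertices of s preceding v. *)
Definition vpos (v : 'I_T) (s : {set 'I_T}) : nat :=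
  #|[set u in s | (u < v)%N]|.

Definition simplex_boundary (s : {set 'I_T}) : C :=
  \sum_(v in s) (-1) ^+ vpos v s *: simplex (s :\ v).

Definition boundary_fun (c : C) : C := \sum_s c s *: simplex_boundary s.

Fact boundary_fun_linear : linear boundary_fun.
Proof.
move=> a c d; rewrite /boundary_fun scaler_sumr -big_split /=.
by apply: eq_bigr => s _; rewrite !ffunE scalerDl scalerA.
Qed.

HB.instance Definition _ :=
  GRing.isLinear.Build F C C *:%R boundary_fun boundary_fun_linear.

Definition boundary : 'End(C) := linfun boundary_fun.

Variable K : complex T.

(* Spanned by the faces with m vertices, i.e. of dimension m - 1. *)
Definition chains (m : nat) : {vspace C} :=
  <<[seq simplex s | s in [set t in K | #|t| == m]]>>%VS.

Definition cycles (k : nat) : {vspace C} :=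
  (chains k.+1 :&: lker boundary)%VS.

Definition boundaries (k : nat) : {vspace C} := (boundary @: chains k.+2)%VS.

(* The quotient of the k-cycles by the k-boundaries, realized as a complement
   of the latter in the former; see homology_class below for the canonical
   projection. *)
Definition reduced_homology (k : nat) : {vspace C} :=
  (cycles k :\: boundaries k)%VS.

Definition homology_class (k : nat) : 'End(C) :=
  addv_pi1 (cycles k) (boundaries k).

Lemma boundary_simplex s : boundary (simplex s) = simplex_boundary s.
Proof.
rewrite lfunE /= /boundary_fun (bigD1 s) //= big1 => [|t /negPf ts].
  by rewrite ffunE eqxx scale1r addr0.
by rewrite ffunE ts scale0r.
Qed.

Lemma boundary_boundary_simplex s : boundary (simplex_boundary s) = 0.
Proof.
pose a v u : C :=
  ((-1) ^+ vpos v s * (-1) ^+ vpos u (s :\ v)) *: simplex (s :\ v :\ u).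
have -> : boundary (simplex_boundary s) =
    \sum_(v in s) \sum_(u in s | u != v) a v u.
  rewrite linear_sum /=; apply: eq_bigr => v vs.
  rewrite linearZ /= boundary_simplex scaler_sumr.
  apply: eq_big => [u|u _]; first by rewrite !inE andbC.
  by rewrite scalerA.
have -> : \sum_(v in s) \sum_(u in s | u != v) a v u =
    \sum_(v in s) (\sum_(u in s | (u < v)%N) a v u
                 + \sum_(u in s | (v < u)%N) a v u).
  apply: eq_bigr => v vs; rewrite (bigID (fun u : 'I_T => (u < v)%N)) /=.
  congr (_ + _); apply: eq_bigl => u; rewrite -val_eqE /=;
    by case: ltngtP; rewrite ?andbT ?andbF.
rewrite big_split /= [X in _ + X](exchange_big_dep (mem s)) /=; last first.
  by move=> i j _ /andP[].
rewrite -big_split big1 //= => v vs.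
rewrite [X in _ + X](eq_bigl (fun i => (i \in s) && (i < v)%N)); last first.
  by move=> u; rewrite vs.
rewrite -big_split big1 //= => u /andP[us uv].
have vposl : vpos u (s :\ v) = vpos u s.
  apply: eq_card => x; rewrite !inE; case: eqP => //= ->.
  by rewrite (ltnNge v) (ltnW uv) andbF.
have vposr : vpos v s = (vpos v (s :\ u)).+1.
  rewrite /vpos (cardsD1 u) !inE us uv add1n; congr _.+1.
  by apply: eq_card => x; rewrite !inE andbA.
rewrite /a vposl vposr (setDDl s [set u]) setUC -setDDl -scalerDl exprS.
by rewrite mulN1r mulNr mulrC addNr scale0r.
Qed.

Lemma boundary_boundary c : boundary (boundary c) = 0.
Proof.
rewrite [boundary c]lfunE /= /boundary_fun linear_sum big1 //= => s _.
by rewrite linearZ /= boundary_boundary_simplex scaler0.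
Qed.

Lemma boundaries_sub_cycles k : (boundaries k <= cycles k)%VS.
Proof.
rewrite subv_cap; apply/andP; split; last first.
  apply/subvP => _ /memv_imgP[c _ ->].
  by rewrite memv_ker boundary_boundary.
rewrite /boundaries limg_span; apply/span_subvP => _ /mapP[_ /imageP[s] + -> ->].
rewrite inE => /andP[sK /eqP szs]; rewrite boundary_simplex.
apply: memv_suml => v vs; apply/memvZ/memv_span/imageP; exists (s :\ v) => //.
rewrite inE (facesS (subD1set s v) sK) /=.
by have := cardsD1 v s; rewrite vs szs add1n => -[<-].
Qed.

Lemma homology_class_image k :
  (homology_class k @: cycles k)%VS = reduced_homology k.
Proof.
apply/eqP; rewrite eqEsubv; apply/andP; split.
  by apply/subvP => _ /memv_imgP[c _ ->]; apply: memv_pi.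
apply/subvP => c cH; apply/memv_imgP; exists c.
  exact: (subvP (diffvSl _ _)) cH.
by rewrite /homology_class /addv_pi1 daddv_pi_id // capv_diff.
Qed.

Lemma homology_class_eq0 k c :
  c \in cycles k -> (homology_class k c == 0) = (c \in boundaries k).
Proof.
move=> cZ; have /addv_pi1_pi2 cE : c \in (cycles k + boundaries k)%VS.
  exact: (subvP (addvSl _ _)) cZ.
apply/eqP/idP => [c0|cB]; first by rewrite -cE c0 add0r memv_pi2.
have := cE; rewrite (addv_pi2_id _ cB) => /eqP.
by rewrite -subr_eq0 addrK => /eqP.
Qed.

End ReducedHomology.

(* The vectors of H are represented by their indices: a set s : {set 'I_T}
   stands for {w j | j in s}, faithfully so when w is injective. *)
Section Arrangement.
Variables (R : realType) (n T : nat) (w : 'I_T -> 'rV[R]_n.+1).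

Definition face_span (s : {set 'I_T}) : {vspace 'rV[R]_n.+1} :=
  <<[seq w j | j in s]>>%VS.

Definition arrangement_faces : {set {set 'I_T}} :=
  [set s | face_span s != fullv].

Fact arrangement_faces0 : set0 \in arrangement_faces.
Proof.
rewrite inE /face_span /image_mem enum_set0 span_nil.
by apply/eqP => /(congr1 (@dimv _ _)); rewrite dimv0 dimvf /dim /= mul1n.
Qed.

Fact arrangement_facesS (s t : {set 'I_T}) :
  t \subset s -> s \in arrangement_faces -> t \in arrangement_faces.
Proof.
move=> ts; rewrite !inE; apply: contra_neq => tfull.
apply/eqP; rewrite eqEsubv subvf -tfull; apply: sub_span => x.
by case/imageP => j jt ->; apply/image_f/(subsetP ts).
Qed.

Definition arrangement_complex : complex T :=
  Complex arrangement_faces0 arrangement_facesS.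

(* H^{x n}_{<> 0}, as tuples of indices into H. *)
Definition independent_tuples : {set n.-tuple 'I_T} :=
  [set W : n.-tuple 'I_T | uniq W && (\dim <<[seq w i | i <- W]>> == n)].

(* Span of the last l vectors of W. *)
Definition tail_span (W : n.-tuple 'I_T) (l : nat) : {vspace 'rV[R]_n.+1} :=
  <<[seq w i | i <- drop (n - l) W]>>%VS.

Definition tail_count (W : n.-tuple 'I_T) (l : nat) : nat :=
  #|[set j | w j \in tail_span W l]|.

Definition flag_weight (W : n.-tuple 'I_T) : nat :=
  \prod_(1 <= l < n.+1) tail_count W l.

End Arrangement.

(* Main.v *)
(* Discarding from the complex K_X of nonspanning subsets of a flat X of rank at
   least 2 the cone of faces s such that s + {a} is nonspanning, a in X, leaves
   the sets spanning a hyperplane Y of X with a not in Y.  For fixed Y these are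
   the faces of a full simplex that are not in K_Y, and different Y do not
   interact under the boundary.  Two long exact sequences with an acyclic term
   give h_k(K_X) = sum of h_(k-1)(K_Y) over the hyperplanes Y of X avoiding a.
   Averaging over a with weights q turns this into
   h(X) = sum over Y of h(Y) (1 - q(Y)).  Taking q = p for the whole space and q
   uniform on X for every smaller flat X, and unfolding down to rank 0, expands
   h into a sum over flags of flats; a flag F_1 < ... < F_n comes from
   prod (|F_l| - |F_(l-1)|) tuples W, whence the sum over W. *)
Require Import Defs.
From HB Require Import structures.
From mathcomp Require Import all_boot all_order all_algebra.
From mathcomp Require Import reals zify.

Set Implicit Arguments.
Unset Strict Implicit.
Unset Printing Implicit Defensive.

Import Order.TTheory GRing.Theory Num.Theory.
Local Open Scope ring_scope.

(** * Chain spaces of arbitrary families of sets *)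

Section Chains.
Variables (F : fieldType) (T : nat).
Local Notation C := {ffun {set 'I_T} -> F^o}.
Local Notation family := {set {set 'I_T}}.
Implicit Types (A B K S : family) (s t : {set 'I_T}) (c : C).

Definition chain_space A : {vspace C} := <<[seq simplex F s | s in A]>>%VS.

Lemma chain_decomp c : c = \sum_s c s *: simplex F s.
Proof.
apply/ffunP => t; rewrite sum_ffunE (bigD1 t) //= big1 => [|s /negPf st].
  by rewrite !ffunE eqxx addr0 /GRing.scale /= mulr1.
by rewrite !ffunE eq_sym st scaler0.
Qed.

Lemma simplex_mem A s : s \in A -> simplex F s \in chain_space A.
Proof. by move=> sA; apply/memv_span/image_f. Qed.

Definition restr_fun A c : C := [ffun s => if s \in A then c s else 0].

Fact restr_fun_linear A : linear (restr_fun A).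
Proof.
move=> a c d; apply/ffunP => s; rewrite !ffunE.
by case: ifP => //; rewrite scaler0 addr0.
Qed.

HB.instance Definition _ A :=
  GRing.isLinear.Build F C C *:%R (restr_fun A) (restr_fun_linear A).

Definition restr A : 'End(C) := linfun (restr_fun A).

Lemma restrE A c s : restr A c s = if s \in A then c s else 0.
Proof. by rewrite lfunE ffunE. Qed.

Lemma chain_spaceP A c :
  reflect (forall s, s \notin A -> c s = 0) (c \in chain_space A).
Proof.
apply: (iffP idP) => [cA s sA|c0].
  have /memv_imgP[d _ ->] : c \in (restr A @: fullv)%VS.
    apply: subvP cA; apply/span_subvP => _ /imageP[t tA ->].
    apply/memv_imgP; exists (simplex F t); rewrite ?memvf //.
    apply/ffunP => u; rewrite restrE ffunE; case: ifPn => // uA.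
    by case: eqP => // ut; rewrite ut tA in uA.
  by rewrite restrE (negPf sA).
rewrite [c]chain_decomp; apply: memv_suml => s _.
case: (boolP (s \in A)) => sA; first exact/memvZ/simplex_mem.
by rewrite c0 // scale0r mem0v.
Qed.

Lemma chain_spaceS A B : A \subset B -> (chain_space A <= chain_space B)%VS.
Proof.
move=> /subsetP AB; apply/subvP => c /chain_spaceP cA.
by apply/chain_spaceP => s sB; apply/cA/(contra (AB s)).
Qed.

Lemma dim_chain_space A : \dim (chain_space A) = #|A|.
Proof.
rewrite /chain_space -[RHS](size_image (@simplex F T)); apply/eqP.
(* [free] unfolds to equality of the dimension of the span with the number of vectors. *)
change (free [seq simplex F s | s in A]).
have fr : free [seq simplex F s | s <- enum A] = true.
  apply/(@freeP _ _ _ (in_tuple _)) => k k0 i.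
  set b := in_tuple _ in k k0 i *.
  have szA : size (enum A) = size [seq simplex F s | s <- enum A].
    by rewrite size_map.
  have iA : (i < size (enum A))%N by rewrite szA.
  have := congr1 (fun c : C => c (nth set0 (enum A) i)) k0.
  rewrite sum_ffunE (bigD1 i) //= big1 => [|j ji].
    rewrite !ffunE (nth_map set0) // ffunE eqxx addr0.
    by rewrite /GRing.scale /= mulr1.
  rewrite !ffunE (nth_map set0) ?szA // ffunE nth_uniq ?szA ?enum_uniq //.
  by rewrite val_eqE eq_sym (negPf ji) scaler0.
exact: fr.
Qed.

Lemma restr_id A c : c \in chain_space A -> restr A c = c.
Proof.
move=> /chain_spaceP cA; apply/ffunP => s; rewrite restrE.
by case: ifPn => // /cA.
Qed.

(** * Grading by cardinality, and relative Betti numbers *)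

Definition layer (m : nat) A : family := [set s in A | #|s| == m].

Lemma boundary_funE c : boundary F T c = \sum_s c s *: simplex_boundary F s.
Proof. by rewrite lfunE. Qed.

Lemma simplex_boundary_supp s t :
  simplex_boundary F s t != 0 -> exists2 v, v \in s & t = s :\ v.
Proof.
rewrite sum_ffunE => h.
have /existsP[v /andP[vs /eqP ->]] : [exists v, (v \in s) && (t == s :\ v)].
  apply: contraNT h => /existsPn h; apply/eqP; rewrite big1 // => v vs.
  have := h v; rewrite vs /= !ffunE => /negPf ->.
  by rewrite scaler0.
by exists v.
Qed.

Lemma boundary_supp c t :
  boundary F T c t != 0 -> exists s v, [/\ c s != 0, v \in s & t = s :\ v].
Proof.
rewrite boundary_funE sum_ffunE => h.
have /existsP[s /andP[cs st]] :
    [exists s, (c s != 0) && (simplex_boundary F s t != 0)].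
  apply: contraNT h => /existsPn h; apply/eqP; rewrite big1 // => s _.
  have := h s; rewrite negb_and !negbK ffunE => /orP[] /eqP ->.
    by rewrite scale0r.
  by rewrite scaler0.
have [v vs ->] := simplex_boundary_supp st; by exists s, v.
Qed.

Definition down_closed A := forall s t, t \subset s -> s \in A -> t \in A.

Lemma boundary_mem A c m : down_closed A ->
  c \in chain_space (layer m.+1 A) -> boundary F T c \in chain_space (layer m A).
Proof.
move=> dA /chain_spaceP cA; apply/chain_spaceP => t tA; apply/eqP.
apply: contraNT tA => /boundary_supp[s [v [cs vs ->]]].
have : s \in layer m.+1 A by apply: contraNT cs => /cA ->.
rewrite !inE => /andP[sA /eqP szs]; rewrite (dA _ _ _ sA) ?subD1set //=.
by have := cardsD1 v s; rewrite vs szs add1n => -[<-].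
Qed.

Lemma boundary_layer0 A c : c \in chain_space (layer 0 A) -> boundary F T c = 0.
Proof.
move=> /chain_spaceP cA; apply/ffunP => t; rewrite ffunE; apply/eqP.
apply: contraT => /boundary_supp[s [v [cs vs _]]].
have : s \in layer 0 A by apply: contraNT cs => /cA ->.
by rewrite !inE cards_eq0 => /andP[_ /eqP s0]; rewrite s0 inE in vs.
Qed.

(* The boundary is truncated to A, so that for A = K :\: S this computes the
   homology of the pair (K, S).  The index m counts vertices: it is the
   dimension plus one. *)
Definition brank (m : nat) A : nat :=
  \dim ((restr A \o boundary F T)%VF @: chain_space (layer m A)).

(** Dimension of the cycles (by rank-nullity) minus dimension of the boundaries. Values in [int]
    avoid truncated subtraction. *)
Definition betti (m : nat) A : int :=
  #|layer m A|%:Z - (brank m A)%:Z - (brank m.+1 A)%:Z.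

Lemma layer_sub m A : layer m A \subset A.
Proof. by apply/subsetP => s; rewrite inE => /andP[]. Qed.

Lemma layerS m A B : A \subset B -> layer m A \subset layer m B.
Proof.
move=> /subsetP AB; apply/subsetP => s; rewrite !inE => /andP[/AB -> ->] //.
Qed.

Lemma boundary_sub A c m : down_closed A ->
  c \in chain_space (layer m A) -> boundary F T c \in chain_space A.
Proof.
move=> dA; case: m => [|m] cA; first by rewrite (boundary_layer0 cA) mem0v.
by apply: subvP (boundary_mem dA cA); apply/chain_spaceS/layer_sub.
Qed.

Lemma brank_closed m A : down_closed A ->
  brank m A = \dim (boundary F T @: chain_space (layer m A)).
Proof.
move=> dA; rewrite /brank; congr (\dim _).
apply: eq_in_limg => c cA; rewrite comp_lfunE restr_id //.
exact: boundary_sub cA.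
Qed.

(* S is a subcomplex, so the relative boundary of K :\: S is the boundary of K
   followed by a projection with kernel the chains of S. *)
Lemma brank_split m K S : down_closed K -> down_closed S ->
  brank m K = (brank m (K :\: S) +
    \dim (boundary F T @: chain_space (layer m K) :&: chain_space S))%N.
Proof.
move=> dK dS; rewrite brank_closed //; set V := (_ @: _)%VS.
(* Rank-nullity for the projection on [V]: the image has dimension [brank m (K :\: S)], and the
   kernel consists of the boundaries supported in [S]. *)
rewrite -(limg_ker_dim (restr (K :\: S)) V) addnC; congr (_ + _)%N.
  rewrite /brank -limg_comp; congr (\dim _); apply/eqP; rewrite eqEsubv.
  apply/andP; split.
    apply/subvP => _ /memv_imgP[c cK ->]; apply/memv_imgP.
    exists (restr (K :\: S) c).
      apply/chain_spaceP => s; rewrite inE restrE; case: ifPn => //= sQ sm.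
      have /chain_spaceP := cK; apply.
      by rewrite inE negb_and sm orbT.
    rewrite !comp_lfunE; apply/eqP; rewrite -subr_eq0 -!linearB /=.
    (* The discarded part of [c] is a chain of [S]; its boundary stays in [S] and is killed by the
       projection. *)
    have /boundary_sub /chain_spaceP h :
        c - restr (K :\: S) c \in chain_space (layer m S).
      apply/chain_spaceP => s sS; rewrite !ffunE restrE.
      have /chain_spaceP cK' := cK; move: (cK' s) sS; rewrite !inE.
      case: (s \in S); case: (s \in K) => /= h1 h2;
        by rewrite ?subrr ?subr0 // h1.
    apply/eqP/ffunP => s; rewrite restrE [RHS]ffunE inE.
    by case: ifPn => // /andP[sS _]; apply: h.
  by apply/limgS/chain_spaceS/layerS/subsetDl.
congr (\dim _); apply/eqP; rewrite eqEsubv !subv_cap !capvSl /=.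
apply/andP; split.
  apply/subvP => _ /memv_capP[/memv_imgP[c cK ->]]; rewrite memv_ker => /eqP r0.
  apply/chain_spaceP => s sS; have := congr1 (fun c : C => c s) r0.
  rewrite restrE !inE sS ffunE /=; case: ifPn => // sK _.
  have /chain_spaceP := boundary_sub dK cK; exact.
apply/subvP => c /memv_capP[_ /chain_spaceP cS]; rewrite memv_ker; apply/eqP.
by apply/ffunP => s; rewrite restrE ffunE inE; case: ifPn => // /andP[/cS].
Qed.

(** * Long exact sequences with an acyclic term, as dimension counts *)

(** The case [m = 0] is included: a nonzero multiple of the empty face must bound too, so this is
    vanishing of reduced homology. *)
Definition acyclic A := forall m c, c \in chain_space (layer m A) ->
  boundary F T c = 0 ->
  c \in (boundary F T @: chain_space (layer m.+1 A))%VS.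

Lemma dim_cycles m A : down_closed A ->
  (\dim (chain_space (layer m A) :&: lker (boundary F T)) + brank m A
     = #|layer m A|)%N.
Proof. by move=> dA; rewrite brank_closed // limg_ker_dim dim_chain_space. Qed.

Lemma acyclic_rank m A : down_closed A -> acyclic A ->
  (brank m.+1 A + brank m A = #|layer m A|)%N.
Proof.
move=> dA aA; rewrite -(dim_cycles m dA) [in LHS]brank_closed //.
congr (\dim _ + _)%N; apply/eqP; rewrite eqEsubv; apply/andP; split.
  apply/subvP => _ /memv_imgP[c cA ->]; rewrite memv_cap boundary_mem //=.
  by rewrite memv_ker boundary_boundary.
by apply/subvP => c /memv_capP[cA]; rewrite memv_ker => /eqP; apply: aA.
Qed.

Lemma card_layerD m K S : S \subset K ->
  #|layer m K| = (#|layer m (K :\: S)| + #|layer m S|)%N.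
Proof.
move=> SK; rewrite -(cardsID S (layer m K)) addnC; congr (_ + _)%N.
  by apply: eq_card => s; rewrite !inE andbA.
apply: eq_card => s; rewrite !inE andbC andbA; congr (_ && _).
by case: (boolP (s \in S)) => // /(subsetP SK).
Qed.

(** A boundary of [K] supported in [S] is a cycle of [S], hence bounds in [S]. So the ranks for [K]
    are the sums of those for [K :\: S] and [S], and the contribution of [S] cancels by
    [acyclic_rank]. *)
Lemma betti_acyclic_sub m K S : down_closed K -> down_closed S ->
  S \subset K -> acyclic S -> betti m K = betti m (K :\: S).
Proof.
move=> dK dS SK aS.
have rk k : brank k K = (brank k (K :\: S) + brank k S)%N.
  rewrite (brank_split k dK dS) (brank_closed k dS); congr (_ + \dim _)%N.
  apply/eqP; rewrite eqEsubv; apply/andP; split.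
    apply/subvP => _ /memv_capP[/memv_imgP[c cK ->] bS].
    case: k cK => [|k] cK; first by rewrite (boundary_layer0 cK) mem0v.
    apply: aS; rewrite ?boundary_boundary //; apply/chain_spaceP => s.
    rewrite inE negb_and => /orP[|sk].
      by move/chain_spaceP: bS; apply.
    have /chain_spaceP := boundary_mem dK cK; apply.
    by rewrite inE negb_and sk orbT.
  rewrite subv_cap limgS /=; last exact/chain_spaceS/layerS.
  by apply/subvP => _ /memv_imgP[c cS ->]; apply: boundary_sub cS.
have := acyclic_rank m dS aS; rewrite /betti !rk (card_layerD m SK); lia.
Qed.

(** Numerical form of the connecting isomorphism: as [K] is acyclic, the boundaries of [K] supported
    in [S] are exactly the cycles of [S]. *)
Lemma betti_acyclic_total m K S : down_closed K -> down_closed S ->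
  S \subset K -> acyclic K -> betti m.+1 (K :\: S) = betti m S.
Proof.
move=> dK dS SK aK.
have rk k : (brank k.+1 K + brank k S = brank k.+1 (K :\: S) + #|layer k S|)%N.
  rewrite (brank_split k.+1 dK dS) -(dim_cycles k dS) addnA.
  congr (_ + \dim _ + _)%N.
  apply/eqP; rewrite eqEsubv; apply/andP; split; apply/subvP => c /memv_capP[].
    move=> /memv_imgP[d dK' ->] bS; rewrite memv_cap memv_ker boundary_boundary.
    rewrite eqxx andbT; apply/chain_spaceP => s; rewrite inE negb_and => /orP[|sk].
      by move/chain_spaceP: bS; apply.
    have /chain_spaceP := boundary_mem dK dK'; apply.
    by rewrite inE negb_and sk orbT.
  rewrite memv_ker => cS /eqP c0; rewrite memv_cap; apply/andP; split.
    by apply: aK => //; apply: subvP cS; apply/chain_spaceS/layerS.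
  by apply: subvP cS; apply/chain_spaceS/layer_sub.
have := acyclic_rank m.+1 dK aK; have := rk m; have := rk m.+1.
rewrite /betti (card_layerD m.+1 SK); lia.
Qed.

(** * Additivity over pieces that do not interact *)

(** The last hypothesis with [t = s] makes the pieces disjoint; with [t] a facet of [s] it says that
    no boundary passes from one piece to another. The truncated boundary is thus block diagonal. *)
Lemma brank_bigU (I : finType) (P : pred I) (A : family) (U : I -> family) m :
  (forall s, s \in A -> exists2 i, P i & s \in U i) ->
  (forall i, P i -> U i \subset A) ->
  (forall i j s t, P i -> P j -> t \subset s ->
    s \in U i -> t \in U j -> i = j) ->
  brank m A = (\sum_(i | P i) brank m (U i))%N.
Proof.
move=> cov sub sep.
pose V i := ((restr (U i) \o boundary F T) @: chain_space (layer m (U i)))%VS.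
have dirV : directv (\sum_(i | P i) V i).
  apply/directv_sum_independent => u uV u0 i Pi; apply/ffunP => s; rewrite ffunE.
  have uS j : P j -> s \notin U j -> u j s = 0.
    move=> Pj; have /memv_imgP[c _ ->] := uV j Pj.
    by rewrite comp_lfunE restrE => /negPf ->.
  case: (boolP (s \in U i)) => [si|]; last exact: uS.
  have := congr1 (fun c : C => c s) u0.
  rewrite sum_ffunE (bigD1 i) //= big1 ?addr0 ?ffunE // => j /andP[Pj ji].
  apply: uS => //; apply: contra ji => sj.
  by rewrite (sep j i s s).
rewrite /brank -(directvP dirV) /=; congr (\dim _).
(* On chains of [U i], truncating the boundary to [A] or to [U i] gives the same result. *)
have eqr i c : P i -> c \in chain_space (layer m (U i)) ->
    (restr A \o boundary F T)%VF c = (restr (U i) \o boundary F T)%VF c.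
  move=> Pi /chain_spaceP cU; apply/ffunP => t; rewrite !comp_lfunE !restrE.
  case: (boolP (t \in U i)) => [ti|tNi]; first by rewrite (subsetP (sub i Pi)).
  case: ifPn => // tA; apply/eqP; apply: contraNT tNi.
  move=> /boundary_supp[s [v [cs vs tE]]].
  have sU : s \in U i.
    by apply: contraNT cs => sN; rewrite cU // inE (negPf sN).
  have [j Pj tj] := cov t tA.
  by rewrite (sep i j s t) // tE subD1set.
have -> : chain_space (layer m A) =
    (\sum_(i | P i) chain_space (layer m (U i)))%VS.
  apply/eqP; rewrite eqEsubv; apply/andP; split.
    apply/span_subvP => _ /imageP[s + ->]; rewrite inE => /andP[/cov[i Pi si] sm].
    apply: (subvP (sumv_sup i Pi (subvv _))).
    by apply: simplex_mem; rewrite inE si.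
  by apply/subv_sumP => i Pi; apply/chain_spaceS/layerS/sub.
rewrite limg_sum; apply: eq_bigr => i Pi; apply: eq_in_limg => c.
exact: eqr.
Qed.

Lemma betti_bigU (I : finType) (P : pred I) (A : family) (U : I -> family) m :
  (forall s, s \in A -> exists2 i, P i & s \in U i) ->
  (forall i, P i -> U i \subset A) ->
  (forall i j s t, P i -> P j -> t \subset s ->
    s \in U i -> t \in U j -> i = j) ->
  betti m A = \sum_(i | P i) betti m (U i).
Proof.
move=> cov sub sep; rewrite /betti -!natz !(brank_bigU _ cov sub sep) !natr_sum.
have -> : #|layer m A| = (\sum_(i | P i) #|layer m (U i)|)%N.
  under eq_bigr => i _ do rewrite -sum1_card.
  rewrite (exchange_big_dep (mem (layer m A))) /=; last first.
    by move=> i s Pi; apply/(subsetP (layerS _ (sub i Pi))).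
  rewrite -sum1_card; apply: eq_bigr => s; rewrite inE => /andP[sA sm].
  have [i Pi si] := cov s sA.
  rewrite (bigD1 i) /=; last by rewrite Pi inE si.
  rewrite big1 // => j /andP[/andP[Pj]]; rewrite inE => /andP[sj _].
  by rewrite (sep j i s s) ?eqxx.
rewrite natr_sum -!sumrB; by apply: eq_bigr => i _; rewrite !natz.
Qed.

(** * Cones and their contracting homotopy *)

Section Cone.
Variable a : 'I_T.

(** The sign is the one with which deleting [a] from [a |: s] returns [s]; sets already containing
    [a] are sent to 0. *)
Definition cone_fun c : C :=
  \sum_(s : {set 'I_T} | a \notin s)
    ((-1) ^+ vpos a s * c s) *: simplex F (a |: s).

Fact cone_fun_linear : linear cone_fun.
Proof.
move=> k c d; rewrite /cone_fun scaler_sumr -big_split /=.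
apply: eq_bigr => s _; rewrite !ffunE scalerA -scalerDl mulrDr.
by congr ((_ + _) *: _); rewrite /GRing.scale /= mulrCA.
Qed.

HB.instance Definition _ :=
  GRing.isLinear.Build F C C *:%R cone_fun cone_fun_linear.

Definition cone : 'End(C) := linfun cone_fun.

Lemma cone_simplex s : cone (simplex F s) =
  if a \in s then 0 else (-1) ^+ vpos a s *: simplex F (a |: s).
Proof.
rewrite lfunE /= /cone_fun; case: ifPn => aS.
  rewrite big1 // => t aT; rewrite ffunE; case: eqP => [ts|].
    by rewrite ts aS in aT.
  by rewrite mulr0 scale0r.
rewrite (bigD1 s) //= big1 => [|t /andP[_ /negPf ts]].
  by rewrite ffunE eqxx mulr1 addr0.
by rewrite ffunE ts mulr0 scale0r.
Qed.

Lemma vposU1 v s : v \in s -> a \notin s ->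
  vpos v (a |: s) = ((a < v) + vpos v s)%N.
Proof.
move=> vs aS; rewrite /vpos (cardsD1 a) !inE eqxx /=; congr (_ + _)%N.
apply: eq_card => u; rewrite !inE; case: (eqVneq u a) => //= ->.
by rewrite (negPf aS).
Qed.

Lemma vposD1 v s : v \in s -> vpos a s = ((v < a) + vpos a (s :\ v))%N.
Proof.
move=> vs; rewrite /vpos (cardsD1 v) !inE vs /=; congr (_ + _)%N.
by apply: eq_card => u; rewrite !inE andbA.
Qed.

Lemma vposDa s : vpos a (s :\ a) = vpos a s.
Proof.
rewrite /vpos; apply: eq_card => u; rewrite !inE.
by have [->|] := eqVneq u a; rewrite ?ltnn ?andbF.
Qed.

Lemma cone_homotopy c : boundary F T (cone c) + cone (boundary F T c) = c.
Proof.
rewrite [c in RHS]chain_decomp [c in LHS]chain_decomp !linear_sum -big_split /=.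
apply: eq_bigr => s _; rewrite !linearZ -scalerDr; congr (_ *: _).
rewrite /= boundary_simplex cone_simplex [simplex_boundary F s]/simplex_boundary.
rewrite linear_sum /=; under eq_bigr => v _ do rewrite linearZ /= cone_simplex.
(* If [a] is in [s], the cone of [s] is 0 and only the deletion of [a] survives in the other term.
   Otherwise deleting [a] from [a |: s] gives [s] back, and the other deletions cancel in pairs. *)
case: ifPn => aS.
  rewrite linear0 add0r (bigD1 a) //= big1 => [|v /andP[_ va]].
    rewrite !inE eqxx /= addr0 vposDa scalerA -expr2 sqrr_sign scale1r setD1K //.
  by rewrite !inE eq_sym va aS /= scaler0.
rewrite linearZ /= boundary_simplex /simplex_boundary.
rewrite (big_setU1 _ aS) /= scalerDr scalerA.
have -> : vpos a (a |: s) = vpos a s.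
  by rewrite -vposDa setU1K.
rewrite -expr2 sqrr_sign scale1r setU1K // -addrA scaler_sumr -big_split /=.
rewrite big1 ?addr0 // => v vs.
have va : v != a by apply: contraNneq aS => <-.
rewrite !inE (negPf aS) andbF !scalerA.
have -> : (a |: s) :\ v = a |: (s :\ v).
  by apply/setP => u; rewrite !inE; case: (eqVneq u a) => // ->; rewrite eq_sym va.
rewrite -scalerDl vposU1 // (vposD1 vs) !exprD.
(* Exactly one of [a < v] and [v < a] holds, whence the opposite signs. *)
have -> : (-1) ^+ (a < v)%N = - (-1) ^+ (v < a)%N :> F.
  move: va; rewrite -val_eqE /=.
  by case: ltngtP => // _ _; rewrite ?expr0 ?expr1 ?opprK.
set e := (-1) ^+ (v < a)%N; have ee : e * e = 1 by rewrite -expr2 sqrr_sign.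
rewrite [X in X *: _](_ : _ = 0) ?scale0r //.
by rewrite mulrACA mulrN ee mulN1r [X in - X]mulrC addNr.
Qed.

(** By the homotopy, a cycle [c] is the boundary of [cone c], which remains a chain of [A]. *)
Lemma cone_acyclic A : (forall s, s \in A -> a |: s \in A) -> acyclic A.
Proof.
move=> aA m c cA c0; apply/memv_imgP; exists (cone c).
  rewrite lfunE /=; apply: memv_suml => s aS.
  case: (boolP (s \in layer m A)) => sA; last first.
    by have /chain_spaceP -> := cA; rewrite ?mulr0 ?scale0r ?mem0v.
  apply/memvZ/simplex_mem; move: sA; rewrite !inE => /andP[/aA -> /eqP szs] /=.
  by rewrite cardsU1 aS szs.
by rewrite -[LHS]cone_homotopy c0 linear0 addr0.
Qed.
End Cone.

Lemma dim_reduced_homology (K : complex T) k :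
  (\dim (reduced_homology F K k))%:Z = betti k.+1 K.
Proof.
have dK : down_closed K by exact: facesS.
rewrite /betti (brank_closed k.+2 dK) -/(chains F K k.+2) -/(boundaries F K k).
have := dim_cycles k.+1 dK; rewrite -/(chains F K k.+1) -/(cycles F K k).
have := dimv_cap_compl (cycles F K k) (boundaries F K k).
have /capv_idPr -> := boundaries_sub_cycles F K k.
rewrite -/(reduced_homology F K k) => <- <-.
by rewrite !PoszD addrK [X in X - _]addrC addrK.
Qed.
End Chains.

(** The head is summed innermost: the flag of a tuple is built from its suffixes, so tuples grow at
    the head. *)
Lemma big_tupleS (I : finType) (V : nmodType) l (P : pred (l.+1.-tuple I))
    (f : l.+1.-tuple I -> V) :
  \sum_(W | P W) f W =
  \sum_(W : l.-tuple I) \sum_(j | P [tuple of j :: W]) f [tuple of j :: W].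
Proof.
rewrite (exchange_big_dep predT) //= pair_big_dep /=.
rewrite (reindex (fun q : I * l.-tuple I => [tuple of q.1 :: q.2])) //=.
exists (fun W => (thead W, [tuple of behead W])) => [[j W] _|W _] /=.
  by congr (_, _); apply/val_inj.
by rewrite -tuple_eta.
Qed.

(** * Rank, closure and flats of the vector configuration *)

Section Flats.
Variables (F : fieldType) (R : realType) (n T : nat) (w : 'I_T -> 'rV[R]_n.+1).
Implicit Types (s t X Y : {set 'I_T}) (a j : 'I_T).
Local Notation betti := (betti F).

Definition rk s : nat := \dim (face_span w s).

Definition cl s : {set 'I_T} := [set j | w j \in face_span w s].

Definition flat X := cl X == X.

Definition nonspanning X : {set {set 'I_T}} :=
  [set s : {set 'I_T} | (s \subset X) && (rk s < rk X)%N].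

Definition spanning X : {set {set 'I_T}} :=
  [set s : {set 'I_T} | (s \subset X) && (rk s == rk X)].

Lemma face_spanP s (V : {vspace 'rV[R]_n.+1}) :
  reflect (forall j, j \in s -> w j \in V) (face_span w s <= V)%VS.
Proof.
apply: (iffP span_subvP) => [h j js|h _ /imageP[j js ->]]; last exact: h.
exact/h/image_f.
Qed.

Lemma face_span_mem s j : j \in s -> w j \in face_span w s.
Proof. by move=> js; apply/memv_span/image_f. Qed.

Lemma face_spanS s t : s \subset t -> (face_span w s <= face_span w t)%VS.
Proof. by move=> /subsetP st; apply/face_spanP => j /st /face_span_mem. Qed.

Lemma rkS s t : s \subset t -> (rk s <= rk t)%N.
Proof. by move=> /face_spanS /dimvS. Qed.

Lemma sub_cl s : s \subset cl s.
Proof. by apply/subsetP => j js; rewrite inE face_span_mem. Qed.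

Lemma face_span_cl s : face_span w (cl s) = face_span w s.
Proof.
apply/eqP; rewrite eqEsubv (face_spanS (sub_cl s)) andbT.
by apply/face_spanP => j; rewrite inE.
Qed.

Lemma rk_cl s : rk (cl s) = rk s.
Proof. by rewrite /rk face_span_cl. Qed.

Lemma flat_cl s : flat (cl s).
Proof. by apply/eqP/setP => j; rewrite !inE face_span_cl. Qed.

Lemma clS s t : s \subset t -> cl s \subset cl t.
Proof.
by move=> /face_spanS st; apply/subsetP => j; rewrite !inE => /(subvP st).
Qed.

Lemma cl_sub s X : flat X -> s \subset X -> cl s \subset X.
Proof. by move=> /eqP {2}<-; apply: clS. Qed.

Lemma cl_eq s t : s \subset t -> (rk t <= rk s)%N -> cl s = cl t.
Proof.
move=> st ts; have /eqP e : face_span w s == face_span w t.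
  by rewrite eqEdim face_spanS.
by apply/setP => j; rewrite !inE e.
Qed.

Lemma cl_flat s X : flat X -> s \subset X -> (rk X <= rk s)%N -> cl s = X.
Proof. by move=> /eqP fX sX rX; rewrite (cl_eq sX rX). Qed.

Lemma face_spanU1 a s : face_span w (a |: s) = (<[w a]> + face_span w s)%VS.
Proof.
apply/eqP; rewrite eqEsubv subv_add face_spanS ?subsetUr // -memvE.
rewrite face_span_mem ?setU11 // !andbT.
apply/face_spanP => j; rewrite !inE => /orP[/eqP ->|js].
  exact/(subvP (addvSl _ _))/memv_line.
exact/(subvP (addvSr _ _))/face_span_mem.
Qed.

Lemma rkU1 a s : rk (a |: s) = ((a \notin cl s) + rk s)%N.
Proof.
rewrite /rk face_spanU1 inE; case: (boolP (w a \in _)) => [aS|aS].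
  by rewrite add0n; congr (\dim _); apply/addv_idPr; rewrite -memvE.
rewrite dimv_disjoint_sum ?dim_vline.
  by have -> : w a != 0 by apply: contraNneq aS => ->; rewrite mem0v.
apply/eqP; rewrite -subv0; apply/subvP => v /memv_capP[/vlineP[k ->]].
case: (eqVneq k 0) => [->|k0]; first by rewrite scale0r !mem0v.
by move=> /(memvZ k^-1); rewrite scalerA mulVf // scale1r (negPf aS).
Qed.

(** * Homology of the complexes of nonspanning subsets *)

Lemma nonspanning_closed X : down_closed (nonspanning X).
Proof.
move=> s t ts; rewrite !inE => /andP[sX rs].
by rewrite (subset_trans ts sX) (leq_ltn_trans (rkS ts)).
Qed.

Lemma powerset_closed X : down_closed (powerset X).
Proof. by move=> s t ts; rewrite !inE; apply: subset_trans. Qed.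

Lemma spanningE X : spanning X = powerset X :\: nonspanning X.
Proof.
apply/setP => s; rewrite !inE; case: (boolP (s \subset X)) => //= sX.
by rewrite -leqNgt eqn_leq rkS // andbT.
Qed.

Lemma rk0 : rk set0 = 0%N.
Proof. by rewrite /rk /face_span /image_mem enum_set0 span_nil dimv0. Qed.

(** The full simplex on [X] is a cone over any of its vertices, hence acyclic; positive rank
    supplies a vertex. *)
Lemma betti_spanning X m : (0 < rk X)%N ->
  betti m.+1 (spanning X) = betti m (nonspanning X).
Proof.
move=> rX; have [b bX] : exists b, b \in X.
  by apply/set0Pn; apply: contraTneq rX => ->; rewrite rk0.
rewrite spanningE; apply: betti_acyclic_total.
- exact: powerset_closed.
- exact: nonspanning_closed.
- by apply/subsetP => s; rewrite !inE => /andP[].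
- by apply: (cone_acyclic (a := b)) => s; rewrite !inE subUset sub1set bX.
Qed.

Definition coatom X Y := [&& flat Y, Y \subset X & (rk Y).+1 == rk X].

(** [S] is a cone with apex [a]. The faces outside [S] are grouped by closure; nested faces of equal
    rank have the same closure, so the groups do not interact. *)
Lemma betti_nonspanningS X a m : flat X -> (1 < rk X)%N -> a \in X ->
  betti m.+1 (nonspanning X) =
  \sum_(Y | coatom X Y && (a \notin Y)) betti m (nonspanning Y).
Proof.
move=> fX rX aX; pose S := [set s : {set 'I_T} | a |: s \in nonspanning X].
have dS : down_closed S.
  move=> s t ts; rewrite inE => h; rewrite inE.
  by apply: nonspanning_closed h; apply: setUS.
rewrite (@betti_acyclic_sub _ _ _ _ S) //; first last.
- by apply: (cone_acyclic (a := a)) => s; rewrite !inE setUA setUid.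
- apply/subsetP => s; rewrite inE; apply: nonspanning_closed.
  exact: subsetUr.
- exact: nonspanning_closed.
rewrite (@betti_bigU _ _ _ (fun Y => coatom X Y && (a \notin Y)) _ spanning).
(* Since [1 < rk X], every coatom has positive rank, as [betti_spanning] requires. *)
- apply: eq_bigr => Y /andP[/and3P[_ _ /eqP rY] _].
  by apply: betti_spanning; rewrite -ltnS rY.
- move=> s; rewrite !inE subUset sub1set aX /= rkU1 => /andP[+ /andP[sX rs]].
  rewrite sX /= -leqNgt => rXs.
  (* Adding [a] lifts the rank from below [rk X] to at least [rk X]; a single vector adds at most
     one, so [cl s] is a coatom avoiding [a]. *)
  have aS : a \notin cl s.
    by apply: contraL rs => aS; rewrite aS add0n in rXs *; lia.
  exists (cl s); last by rewrite inE sub_cl rk_cl eqxx.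
  rewrite /coatom flat_cl cl_sub // rk_cl aS andbT /=.
  by rewrite aS in rXs; lia.
- move=> Y /andP[/and3P[fY YX /eqP rY] aY]; apply/subsetP => s.
  rewrite !inE => /andP[sY /eqP rs]; rewrite subUset sub1set aX rkU1.
  rewrite (cl_flat fY sY) ?rs // aY (subset_trans sY YX) /=.
  by rewrite -rY add1n ltnn leqnn.
- move=> Y Z s t /andP[/and3P[fY _ /eqP rY] _] /andP[/and3P[fZ _ /eqP rZ] _] ts.
  rewrite !inE => /andP[sY /eqP rs] /andP[tZ /eqP rt].
  rewrite -(cl_flat fY sY) ?rs // -(cl_flat fZ tZ) ?rt //.
  by rewrite (cl_eq ts) // rs rt -ltnS rY rZ.
Qed.

Hypothesis w_neq0 : forall j, w j != 0.

Lemma rk_eq0 s : (rk s == 0%N) = (s == set0).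
Proof.
apply/idP/eqP => [|->]; last by rewrite rk0.
apply: contraTeq => /set0Pn[j js]; rewrite /rk dimv_eq0.
apply: contraNneq (w_neq0 j) => s0; have := face_span_mem js.
by rewrite s0 memv0.
Qed.

Lemma flat0 : flat set0.
Proof. by rewrite /flat -rk_eq0 rk_cl rk0. Qed.

(** The complex has the empty face only, which is a cycle in degree -1 and bounds nothing. *)
Lemma betti_nonspanning0 X : rk X = 1%N -> betti 0 (nonspanning X) = 1.
Proof.
move=> rX; have K0 : nonspanning X = [set set0].
  apply/setP => s; rewrite !inE rX ltnS leqn0 rk_eq0.
  by case: eqP => [->|]; rewrite ?sub0set ?andbF.
have l1 : layer 1 [set set0] = set0 :> {set {set 'I_T}}.
  by apply/setP => s; rewrite !inE; case: eqP => [->|//]; rewrite cards0.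
have l0 : layer 0 [set set0] = [set set0] :> {set {set 'I_T}}.
  by apply/setP => s; rewrite !inE; case: eqP => [->|//]; rewrite cards0.
have dK := @nonspanning_closed X; rewrite K0 in dK *.
have b1 : brank F 1 [set set0 : {set 'I_T}] = 0%N.
  rewrite /brank l1 (_ : chain_space F set0 = 0%VS) ?limg0 ?dimv0 //.
  by apply/eqP; rewrite -dimv_eq0 dim_chain_space cards0.
have b0 : brank F 0 [set set0 : {set 'I_T}] = 0%N.
  rewrite brank_closed //; apply/eqP; rewrite dimv_eq0 -subv0.
  apply/subvP => _ /memv_imgP[c cK ->]; by rewrite (boundary_layer0 cK) mem0v.
by rewrite /betti b0 b1 l0 cards1.
Qed.

(** * Recursion over the lattice of flats *)

(** In rank [r.+1] the index [r] counts vertices, so the homological degree is [r - 1]. The value 1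
    in rank 0 makes the recursion start correctly in rank 1. *)
Definition flat_betti X : int :=
  if rk X is r.+1 then betti r (nonspanning X) else 1.

(** This is the recursion that Weisner's theorem gives for the absolute value of the Möbius function
    of the lattice of flats. *)
Lemma flat_betti_rec X a : flat X -> a \in X ->
  flat_betti X = \sum_(Y | coatom X Y && (a \notin Y)) flat_betti Y.
Proof.
move=> fX aX; case rX: (rk X) => [|[|r]].
- by move/eqP: rX aX; rewrite rk_eq0 => /eqP ->; rewrite inE.
- rewrite /flat_betti rX betti_nonspanning0 // (big_pred1 set0) ?rk0 // => Y /=.
  rewrite /coatom rX eqSS rk_eq0; case: eqP => [->|]; last by rewrite !andbF.
  by rewrite flat0 sub0set inE.
rewrite /flat_betti rX (betti_nonspanningS _ fX _ aX) ?rX //.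
apply: eq_bigr => Y /andP[/and3P[_ _]]; rewrite rX eqSS => /eqP -> _ //.
Qed.

(** Weight the recursion at [j] by [q j] and sum over [X]: a coatom [Y] is counted for each [j] in
    [X] outside [Y]. *)
Lemma flat_betti_avg X (q : 'I_T -> R) : flat X -> \sum_(j in X) q j = 1 ->
  (flat_betti X)%:~R =
  \sum_(Y | coatom X Y) (flat_betti Y)%:~R * (1 - \sum_(j in Y) q j) :> R.
Proof.
move=> fX q1.
transitivity ((flat_betti X)%:~R * \sum_(j in X) q j).
  by rewrite q1 mulr1.
rewrite mulr_sumr.
transitivity (\sum_(j in X) \sum_(Y | coatom X Y && (j \notin Y))
    (flat_betti Y)%:~R * q j).
  apply: eq_bigr => j jX; rewrite (flat_betti_rec fX jX) mulrz_sumr.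
  by rewrite mulr_suml.
rewrite (exchange_big_dep (coatom X)) /=; last by move=> j Y _ /andP[].
apply: eq_bigr => Y /[dup] cY /and3P[_ /subsetP YX _].
rewrite -mulr_sumr; congr (_ * _).
rewrite -q1 [in RHS](bigID (mem Y)) /=.
have -> : \sum_(j in X | j \in Y) q j = \sum_(j in Y) q j.
  by apply: eq_bigl => j; case: (boolP (j \in Y)) => [/YX ->|]; rewrite ?andbF.
by rewrite addrAC subrr add0r; apply: eq_bigl => j; rewrite cY.
Qed.

(** * From flags of flats to independent tuples *)

Implicit Type l : nat.

Definition tuple_cl (r : seq 'I_T) : {set 'I_T} := cl [set j in r].

(** [W[H]] written as a recursion on the head, one factor per nonempty suffix. *)
Fixpoint seq_weight (r : seq 'I_T) : nat :=
  if r is j :: r' then (#|tuple_cl r| * seq_weight r')%N else 1%N.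

Definition indep (r : seq 'I_T) := free [seq w j | j <- r].

Lemma face_span_seq (r : seq 'I_T) :
  face_span w [set j in r] = <<[seq w j | j <- r]>>%VS.
Proof.
apply: eq_span => v; apply/imageP/mapP => -[j jr ->]; exists j => //.
  by rewrite inE in jr.
by rewrite inE.
Qed.

Lemma rk_indep r : indep r -> rk [set j in r] = size r.
Proof. by rewrite /rk face_span_seq /indep /free size_map => /eqP. Qed.

Lemma indep_uniq r : indep r -> uniq r.
Proof. by move=> /free_uniq; apply: map_uniq. Qed.

Lemma tuple_cl_cons j r : tuple_cl (j :: r) = cl (j |: [set i in r]).
Proof. by congr cl; apply/setP => i; rewrite !inE. Qed.

Lemma indep_cons j r : indep (j :: r) = (j \notin tuple_cl r) && indep r.
Proof. by rewrite /indep /= free_cons inE face_span_seq. Qed.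

Definition flag_sum l X : R :=
  \sum_(W : l.-tuple 'I_T | indep W && (tuple_cl W == X)) (seq_weight W)%:R^-1.

(** A vector outside the closure of [W] raises the rank by exactly one, which is what a coatom
    lacks. For fixed [W], the admissible heads [j] are therefore the elements of a set
    difference. *)
Lemma coatom_tuple X l (W : l.-tuple 'I_T) j :
  flat X -> rk X = l.+1 -> indep W ->
  (j \notin tuple_cl W) && (tuple_cl (j :: W) == X) =
  coatom X (tuple_cl W) && (j \in X :\: tuple_cl W).
Proof.
move=> fX rX iW; rewrite in_setD /coatom flat_cl /tuple_cl rk_cl.
rewrite rk_indep // size_tuple rX eqxx andbT /= [RHS]andbCA; case: (boolP (j \in _)) => //= jW.
rewrite -/(tuple_cl _) tuple_cl_cons; apply/eqP/andP => [<-|[WX jX]].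
  split; last by apply: (subsetP (sub_cl _)); rewrite setU11.
  exact/clS/subsetUr.
apply: cl_flat => //; last by rewrite rkU1 jW rk_indep // size_tuple rX.
by rewrite subUset sub1set jX (subset_trans (sub_cl _) WX).
Qed.

Lemma flat_betti_flag_sum l X : flat X -> rk X = l ->
  (flat_betti X)%:~R = flag_sum l X.
Proof.
elim: l X => [|l IHl] X fX rX.
  have X0 : X = set0 by apply/eqP; rewrite -rk_eq0 rX.
  rewrite /flat_betti rX /flag_sum (big_pred1 [tuple]) /= ?invr1 // => W.
  rewrite tuple0 [RHS]eqxx /indep /= nil_free X0 /tuple_cl.
  rewrite (_ : [set j in [::]] = set0); first exact: flat0.
  by apply/setP => j; rewrite !inE.
have X0 : #|X|%:R != 0 :> R by rewrite pnatr_eq0 cards_eq0 -rk_eq0 rX.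
(* Uniform weights on [X] turn the factor of a coatom [Y] into [1 - #|Y| / #|X|]. *)
rewrite (flat_betti_avg (q := fun=> #|X|%:R^-1) fX); last first.
  by rewrite sumr_const -[LHS]mulr_natr mulVf.
rewrite /flag_sum big_tupleS.
transitivity (\sum_(Y | coatom X Y)
   \sum_(W : l.-tuple 'I_T | indep W && (tuple_cl W == Y))
   (seq_weight W)%:R^-1 * (1 - #|tuple_cl W|%:R / #|X|%:R) : R).
  apply: eq_bigr => Y /and3P[fY _]; rewrite rX eqSS => /eqP rY.
  rewrite IHl // /flag_sum mulr_suml; apply: eq_bigr => W /andP[_ /eqP ->].
  by rewrite sumr_const -[X in 1 - X]mulr_natl.
transitivity (\sum_(W : l.-tuple 'I_T | indep W && coatom X (tuple_cl W))
   (seq_weight W)%:R^-1 * (1 - #|tuple_cl W|%:R / #|X|%:R) : R).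
  rewrite [RHS](partition_big (fun W : l.-tuple 'I_T => tuple_cl W)
    (coatom X)) /=; last first.
    by move=> W /andP[].
  apply: eq_bigr => Y cY; apply: eq_bigl => W.
  by case: eqP => [->|]; rewrite ?andbF // cY !andbT.
rewrite [LHS]big_mkcond /=; apply: eq_bigr => W _.
under [RHS]eq_bigl => j do rewrite indep_cons andbAC.
case: (boolP (indep W)) => iW /=; last first.
  by rewrite big_pred0 // => j; rewrite !andbF.
under [RHS]eq_bigl => j do rewrite andbT coatom_tuple //.
case: ifPn => cW; last by rewrite big_pred0.
under eq_bigr => j jW.
  have /andP[_ /eqP ->] : (j \notin tuple_cl W) && (tuple_cl (j :: W) == X).
    by rewrite coatom_tuple // cW.
  over.
(* There are [#|X| - #|tuple_cl W|] heads, each contributing the new factor [1 / #|X|]; this matches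
   the uniform average. *)
rewrite sumr_const cardsD; have /and3P[_ /setIidPr -> _] := cW.
have /and3P[_ /subset_leq_card WX _] := cW.
rewrite -[RHS]mulr_natl natrB // natrM invfM mulrA [RHS]mulrC; congr (_ * _).
by rewrite mulrBl divff.
Qed.
End Flats.

(** * Translation back to the arrangement *)

Lemma arrangement_facesE (R : realType) (n T : nat)
    (w : 'I_T -> 'rV[R]_n.+1) :
  <<[seq w j | j : 'I_T]>>%VS = fullv ->
  (rk w setT = n.+1) * (arrangement_complex w = nonspanning w setT :> {set _}).
Proof.
move=> w_span; have fT : face_span w setT = fullv.
  rewrite -w_span; apply: eq_span => v.
  by apply/imageP/imageP => -[j _ ->]; exists j.
have rT : rk w setT = n.+1 by rewrite /rk fT dimvf /dim /= mul1n.
split=> //; apply/setP => s; rewrite !inE subsetT /= ltn_neqAle.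
rewrite rkS ?subsetT // andbT; congr (~~ _); rewrite eqEdim subvf /= -fT.
by rewrite eqn_leq (rkS _ (subsetT s)).
Qed.

Lemma seq_weightE (R : realType) (n T : nat) (w : 'I_T -> 'rV[R]_n.+1)
    (r : seq 'I_T) :
  (\prod_(1 <= l < (size r).+1) #|tuple_cl w (drop (size r - l) r)|)%N =
  seq_weight w r.
Proof.
elim: r => [|j r IHr]; first by rewrite big_geq.
(* The top factor is that of the whole sequence; every shorter suffix already lies in the tail. *)
rewrite big_nat_recr //= subnn drop0 -IHr mulnC; congr (_ * _)%N.
by apply: eq_big_nat => l /andP[_ lr]; rewrite subSn.
Qed.

Lemma flag_weightE (R : realType) (n T : nat) (w : 'I_T -> 'rV[R]_n.+1)
    (W : n.-tuple 'I_T) : flag_weight w W = seq_weight w W.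
Proof.
have tcE l : tail_count w W l = #|tuple_cl w (drop (n - l) W)|.
  by apply: eq_card => j; rewrite !inE face_span_seq.
by rewrite /flag_weight -seq_weightE size_tuple; apply: eq_bigr.
Qed.

Theorem theorem1 (R : realType) (F : fieldType) (n T : nat)
    (w : 'I_T -> 'rV[R]_n.+1) (p : 'I_T -> R)
    (n_ge1 : (1 <= n)%N)
    (w_neq0 : forall j, w j != 0)
    (w_nonprop : forall i j, i != j -> forall a : R, w i != a *: w j)
    (w_span : <<[seq w j | j : 'I_T]>>%VS = fullv)
    (p_ge0 : forall j, 0 <= p j)
    (p_sum1 : \sum_j p j = 1) :
  (\dim (reduced_homology F (arrangement_complex w) n.-1))%:R =
  \sum_(W in independent_tuples w)
     (1 - \sum_(j | w j \in tail_span w W n) p j) / (flag_weight w W)%:R :> R.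
Proof.
have [rT KE] := arrangement_facesE w_span.
have fT : flat w setT.
  by rewrite /flat eqEsubset subsetT; apply: sub_cl.
transitivity ((flat_betti F w setT)%:~R : R).
  (* Degree [n.-1] means [n] vertices because [1 <= n], and this is the index used by [flat_betti]
     in rank [n.+1]. *)
  rewrite [LHS]pmulrn dim_reduced_homology prednK // KE.
  by rewrite /flat_betti rT.
rewrite (flat_betti_avg F w_neq0 (q := p) fT); last first.
  by rewrite -[RHS]p_sum1; apply: eq_bigl => j; rewrite inE.
rewrite [RHS](eq_bigl (fun W : n.-tuple 'I_T => indep w W)); last first.
  move=> W; rewrite inE.
  have -> : (\dim <<[seq w i | i <- W]>> == n) = indep w W.
    by rewrite /indep /free size_map size_tuple.
  by apply: andb_idl; apply: indep_uniq.
(* Tuples are grouped by the hyperplane they span; the numerator [1 - p(Y)] is constant on each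
   group. *)
rewrite [RHS](partition_big (fun W : n.-tuple 'I_T => tuple_cl w W)
  (coatom w setT)) /=; last first.
  move=> W iW; rewrite /coatom flat_cl subsetT rk_cl rk_indep //.
  by rewrite size_tuple rT /=.
apply: eq_bigr => Y /and3P[fY _]; rewrite rT eqSS => /eqP rY.
rewrite (flat_betti_flag_sum F w_neq0 fY rY) /flag_sum mulr_suml.
apply: eq_bigr => W /andP[_ /eqP <-].
rewrite flag_weightE mulrC; congr ((1 - _) / _).
by apply: eq_bigl => j; rewrite inE face_span_seq /tail_span subnn drop0.
Qed.
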